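(* Let $\{X_t\}$, $\{Y_t\}$ and $\{Z_t\}$ ($t=0,1,2,\dots$) be three sequences of random variables adapted to a filtration $\{\mathcal{F}_t\}$. Suppose that: (1) $X_t$, $Y_t$ and $Z_t$ are nonnegative for all $t\ge 0$; (2) $\mathbb{E}[Y_{t+1}\mid\mathcal{F}_t]\le Y_t-X_t+Z_t$ for all $t\ge 0$; (3) $\sum_{t=0}^\infty Z_t<\infty$ with probability 1. Then $\sum_{t=0}^\infty X_t<\infty$ with probability 1, and $Y_t$ converges with probability 1 to a nonnegative random variable $Y_\infty$.
   Context: All random variables are real-valued and defined on a common probability space with filtration $\{\mathcal{F}_t\}_{t\ge0}$. *)

(* Defs.v *)
(* MathComp-Analysis. [measurable_realfun], which holds the measurable structure
   of [\bar R], is not re-exported by [all_analysis]. *)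
From HB Require Import structures.
From mathcomp Require Import all_boot all_order all_algebra.
From mathcomp Require Import all_classical all_reals all_analysis.
From mathcomp Require Import measurable_realfun.

Set Implicit Arguments.
Unset Strict Implicit.
Unset Printing Implicit Defensive.

Import Order.TTheory GRing.Theory Num.Theory.
Import numFieldNormedType.Exports.

Local Open Scope classical_set_scope.
Local Open Scope ring_scope.

(* A sub-sigma-algebra of the ambient one is a set of sets, so that several of
   them can live on the same carrier T. *)
Definition sub_sigma_algebra_of d (T : measurableType d) (G : set (set T)) : Prop :=
  sigma_algebra [set: T] G /\ G `<=` measurable.

(* The library's measurability is relative to the canonical sigma-algebra of the
   domain; [g_sigma_algebraType G] is T equipped with <<s G >>, which is G
   itself when G is a sigma-algebra. *)
Definition measurable_wrt d d' (T : measurableType d) (U : measurableType d')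
    (G : set (set T)) (f : T -> U) : Prop :=
  @measurable_fun _ _ (g_sigma_algebraType G) U setT f.

Definition filtration d (T : measurableType d) (F : nat -> set (set T)) : Prop :=
  (forall t, sub_sigma_algebra_of (F t)) /\
  (forall s t, (s <= t)%N -> F s `<=` F t).

Definition adapted d d' (T : measurableType d) (U : measurableType d')
    (F : nat -> set (set T)) (X : nat -> T -> U) : Prop :=
  forall t, measurable_wrt (F t) (X t).

(* [g] is a version of E[Y | G], for a nonnegative, not necessarily integrable,
   random variable [Y]. As usual for nonnegative variables, the conditional
   expectation takes its values in [0, +oo]; it always exists and is unique up
   to P-almost sure equality. *)
Definition is_condexp d (T : measurableType d) (R : realType)
    (P : probability T R) (G : set (set T)) (Y : T -> R) (g : T -> \bar R) : Prop :=
  [/\ measurable_wrt G g,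
      (forall w, 0 <= g w)%E &
      forall A, G A ->
        (\int[P]_(w in A) g w = \int[P]_(w in A) (Y w)%:E)%E].

(* Main.v *)
Require Import Defs.
From HB Require Import structures.
From mathcomp Require Import all_boot all_order all_algebra.
From mathcomp Require Import all_classical all_reals all_analysis.
From mathcomp Require Import measurable_realfun.
From mathcomp Require Import lra.

Import Order.TTheory GRing.Theory Num.Theory.
Import numFieldNormedType.Exports.

Local Open Scope classical_set_scope.
Local Open Scope ring_scope.

(** This is the almost supermartingale theorem of Robbins and Siegmund.

    Put [S_t = X_0 + ... + X_(t-1)] and [C_t = Z_0 + ... + Z_(t-1)].
    The hypothesis on conditional expectations says that
    [W_t = Y_t + S_t - C_t] decreases in conditional mean: when passing from
    [t] to [t + 1], the sums grow by the [F_t]-measurable amount [X_t - Z_t],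
    and the mean of [Y] drops by at least that much.  But [W] is not bounded
    below, and [Y_0] need not be integrable.  Both defects disappear after
    localization: for a level [a >= 0], keep the path alive as long as
    [Y_0 <= a] and [C_t <= a], and send it to [0] afterwards.  While it is
    alive, [W_t + a >= 0], so killing only decreases the process; moreover
    survival until [t + 1] is known at time [t], because [C_(t+1)] involves
    [Z_0, ..., Z_t] only.  The killed process is therefore a nonnegative
    supermartingale ([killed_supermartingale]) whose initial value is at most
    [2 a].

    Such a process converges almost surely ([supermartingale_cvgn]).  On the
    event where [Z] is summable, a path whose level [a] exceeds [Y_0] and the
    sum of [Z] is never killed, and almost every path has such an integer
    level.  There, [C_t] converges, hence so does [Y_t + S_t]; since
    [Y_t >= 0], the nondecreasing [S_t] is bounded, so it converges, and then
    so does [Y_t] ([cvgn_of_killed]).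

    The convergence of nonnegative supermartingales rests on the counting of
    upcrossings.  Supermartingales are described by integrals over the events
    of [F_t], so that all integrals are those of nonnegative functions and no
    integrability has to be tracked. *)

(** * Convergence of nonnegative real sequences *)

Definition frequently_below {R : realType} (u : nat -> R) (K : R) : Prop :=
  forall N, exists2 t, (N <= t)%N & u t < K.

Definition oscillates {R : realType} (u : nat -> R) (a b : R) : Prop :=
  forall N, (exists2 t, (N <= t)%N & u t <= a) /\
            (exists2 t, (N <= t)%N & b <= u t).

(** The limit is the lower limit, obtained as the supremum of the eventual
    lower bounds of [u].  The bound [K] makes it finite, and a rational gap
    [p < q] just above it that is not crossed forever forces [u] to stay
    below [q] eventually. *)
Lemma cvgn_no_oscillation {R : realType} (u : nat -> R) (K : R)
    (u_ge0 : forall t, 0 <= u t) (u_below : frequently_below u K)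
    (u_osc : forall p q : rat,
       0 <= ratr p :> R -> ratr p < ratr q :> R ->
       ~ oscillates u (ratr p) (ratr q)) :
  cvgn u.
Proof.
pose E := [set x | exists N, forall t, (N <= t)%N -> x <= u t].
have supE : has_sup E.
  split; first by exists 0, 0%N.
  exists K => x [N xu]; have [t Nt utK] := u_below N.
  exact: le_trans (xu t Nt) (ltW utK).
have supE_ge0 : 0 <= sup E by apply: ub_le_sup; [case: supE | exists 0%N].
have below x : sup E < x -> frequently_below u x.
  move=> Ex; apply: contrapT => /existsNP[N noN].
  move: Ex; apply/negP; rewrite -leNgt; apply: ub_le_sup; first by case: supE.
  exists N => t Nt; rewrite leNgt; apply/negP => utx.
  by apply: noN; exists t.
apply: cvgP; apply/cvgrPdist_lt => e e0.
have [x Ex ltx] : exists2 x, E x & sup E - e < x.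
  by have [x Ex ?] := sup_adherent e0 supE; exists x.
have lt_e : sup E < sup E + e by rewrite ltrDl.
have [q /[!in_itv]/= /andP[ltq qe]] := rat_in_itvoo lt_e.
have [p /[!in_itv]/= /andP[ltp pq]] := rat_in_itvoo ltq.
have p0 : 0 <= ratr p :> R by apply: ltW; exact: le_lt_trans ltp.
have ltpq : ratr p < ratr q :> R by [].
have /existsNP[N noN] := u_osc p q p0 ltpq.
have [N1 xN1] := Ex.
exists (maxn N N1) => // t; rewrite /= geq_max => /andP[Nt N1t].
have uq : u t < ratr q.
  rewrite ltNge; apply/negP => qut; apply: noN; split; last by exists t.
  by have [s Ns /ltW us] := below _ ltp N; exists s.
rewrite ltr_distlC; apply/andP; split; last exact: lt_trans uq qe.
  exact: lt_le_trans ltx (xN1 t N1t).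
Qed.

(** * Consequences of Fatou's lemma and measurability in a filtration *)

(** By Fatou's lemma the lower limit has a finite integral, hence it is almost
    everywhere finite. *)
Lemma fatou_frequently_below {d} {T : measurableType d} {R : realType}
    (P : {measure set T -> \bar R}) (f : nat -> T -> R) (M : R)
    (mf : forall n, measurable_fun setT (f n))
    (f_ge0 : forall n w, 0 <= f n w)
    (f_le : forall n, (\int[P]_w (f n w)%:E <= M%:E)%E) :
  {ae P, forall w, exists K, frequently_below (f ^~ w) K}.
Proof.
pose g n w := (f n w)%:E.
have mg n : measurable_fun setT (g n) by exact/measurable_EFinP.
have g0 n w : setT w -> (0 <= g n w)%E by rewrite lee_fin.
have liminf0 w : (0 <= limn_einf (g ^~ w))%E.
  rewrite limn_einf_lim; apply: lime_ge; first exact: is_cvg_einfs.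
  apply: nearW => n; apply: le_ereal_inf_tmp => _ [m _ <-]; exact: g0.
have mliminf : measurable_fun setT (fun w => limn_einf (g ^~ w)).
  under eq_fun do rewrite /limn_einf.
  apply: measurableT_comp => //.
  by apply: measurable_fun_limn_esup => n; exact: measurableT_comp.
have int_le : (\int[P]_w limn_einf (g ^~ w) <= M%:E)%E.
  apply: (le_trans (fatou _ _ mg g0)) => //; rewrite limn_einf_lim.
  apply: lime_le; first exact: is_cvg_einfs.
  apply: nearW => n; apply: le_trans (f_le n).
  by apply: ereal_inf_lbound; exists n => /=.
have /integrable_ae : P.-integrable setT (fun w => limn_einf (g ^~ w)).
  apply/integrableP; split=> //.
  under eq_integral do rewrite gee0_abs//.
  by rewrite (le_lt_trans int_le)// ltry.
move=> /(_ measurableT); apply: filterS => w /(_ I) liminf_fin.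
exists (fine (limn_einf (g ^~ w)) + 1) => N.
have : (einfs (g ^~ w) N < (fine (limn_einf (g ^~ w)) + 1)%:E)%E.
  rewrite EFinD fineK//; apply: (@le_lt_trans _ _ (limn_einf (g ^~ w))).
    have /cvg_lim := ereal_nondecreasing_cvgn (nondecreasing_einfs (g ^~ w)).
    rewrite limn_einf_lim => ->//.
    by apply: ereal_sup_ubound; exists N.
  by rewrite lteDl.
move/ereal_inf_lt => [_ [t /= Nt <-]]; rewrite lte_fin => ?.
by exists t.
Qed.

Lemma ae_forall_countable {d} {T : measurableType d} {R : realType}
    (mu : {measure set T -> \bar R}) (I : countType) (Q : I -> T -> Prop) :
  (forall i, {ae mu, forall w, Q i w}) -> {ae mu, forall w, forall i, Q i w}.
Proof.
move=> aeQ.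
have : {ae mu, forall w, forall n,
    if unpickle n is Some i then Q i w else True}.
  by apply: ae_foralln => n; case: (unpickle n) => [i|]; [|exact: nearW].
by apply: filterS => w Qw i; have := Qw (pickle i); rewrite pickleK.
Qed.

(** The three lemmas below translate between membership in a set of sets [G]
    and the canonical measurability of the space [g_sigma_algebraType G]: the
    two agree because [<<s G >>] is [G]. *)
Lemma measurable_wrtW {d d'} {T : measurableType d} {U : measurableType d'}
    (G H : set (set T)) (f : T -> U) :
  sigma_algebra [set: T] G -> sigma_algebra [set: T] H -> G `<=` H ->
  measurable_wrt G f -> measurable_wrt H f.
Proof.
move=> sG sH GH mf mT B mB; have := mf measurableT B mB.
by rewrite /measurable/= !sigma_algebra_id//; exact: GH.
Qed.

Lemma measurable_wrt_ambient {d d'} {T : measurableType d}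
    {U : measurableType d'} (G : set (set T)) (f : T -> U) :
  sub_sigma_algebra_of G -> measurable_wrt G f -> measurable_fun setT f.
Proof.
move=> [sG Gm] mf mT B mB; have := mf measurableT B mB.
by rewrite {1}/measurable/= sigma_algebra_id//; exact: Gm.
Qed.

Lemma measurable_wrt_bool {d} {T : measurableType d} (G : set (set T))
    (f : T -> bool) :
  sigma_algebra [set: T] G -> measurable_wrt G f -> G [set w | f w].
Proof.
move=> sG mf; have := mf measurableT [set true] I.
rewrite {1}/measurable/= sigma_algebra_id// setTI.
by congr G; apply/seteqP; split.
Qed.

(** * Upcrossings *)

(** The parity of the counter [c] records the phase: it is even while waiting
    for a value below [a], and odd while waiting for a value above [b].  Thus
    [c./2] is the number of completed upcrossings, and a single natural number
    carries both pieces of information. *)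
Definition switch {R : realType} (a b : R) (c : nat) (v : R) : nat :=
  (c + (if odd c then (b <= v)%R else (v <= a)%R))%N.

Fixpoint switches {R : realType} (a b : R) (u : nat -> R) (t : nat) : nat :=
  switch a b (if t is s.+1 then switches a b u s else 0%N) (u t).

Lemma switches_homo {R : realType} (a b : R) (u : nat -> R) :
  {homo switches a b u : s t / (s <= t)%N}.
Proof.
apply: (@homo_leq _ (switches a b u) leq) => // [y x z|n].
  exact: leq_trans.
exact: leq_addr.
Qed.

(** When [a < b], the phase is odd at each time where [u] is below [a] and even
    at each time where [u] is above [b]; so the counter changes parity, hence
    increases, infinitely often. *)
Lemma switches_unbounded {R : realType} (a b : R) (u : nat -> R) :
  a < b -> oscillates u a b -> forall k N,
  exists2 t, (N <= t)%N & (k <= switches a b u t)%N.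
Proof.
move=> ab osc.
have odd_low t : u t <= a -> odd (switches a b u t).
  move=> uta; have /negbTE utb : ~~ (b <= u t).
    by rewrite -ltNge (le_lt_trans uta).
  case: t uta utb => [|t] uta utb /=; rewrite /switch uta utb//.
  by case: ifP => // o; rewrite ?addn0 ?addn1//= o.
have even_high t : b <= u t -> ~~ odd (switches a b u t).
  move=> utb; have /negbTE uta : ~~ (u t <= a).
    by rewrite -ltNge (lt_le_trans ab).
  case: t uta utb => [|t] uta utb /=; rewrite /switch uta utb//.
  by case: ifP => o; rewrite ?addn0 ?addn1//= o.
elim=> [|k IH] N; first by exists N.
have [t Nt kt] := IH N.
have [s ts par] : exists2 s, (t <= s)%N & odd (switches a b u s) = ~~ odd k.
  have [[s1 ts1 /odd_low o1] [s2 ts2 /even_high e2]] := osc t.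
  by case: (odd k); [exists s2 => //; exact: negbTE|exists s1].
exists s; first exact: leq_trans ts.
rewrite ltn_neqAle (leq_trans kt (switches_homo _ _ _ _ _ ts)) andbT.
by apply: contraPneq par => <-; case: odd.
Qed.

(** The capital of a gambler who stakes [a] at the beginning of each
    upcrossing, follows the process until it rises above [b], and then puts
    aside the gain, counted as [b - a]. *)
Definition potential {R : realType} (a b : R) (c : nat) (v : R) : R :=
  (b - a) * (c./2)%:R + (if odd c then v else a).

(** A switch never creates capital: if [v <= a] the stake [a] is replaced by the
    smaller [v], and if [b <= v] the holding [v] is replaced by the smaller
    [a + (b - a)]. *)
Lemma potential_switch {R : realType} (a b : R) (c : nat) (v : R) :
  potential a b (switch a b c v) v <= potential a b c v.
Proof.
rewrite /potential /switch.
have [oc|ec] := ifPn.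
  have [bv|] := boolP (b <= v); last by rewrite addn0 oc.
  by rewrite addn1 /= uphalf_half oc /= natrD; lra.
have [va|] := boolP (v <= a); last by rewrite addn0 (negbTE ec).
by rewrite addn1 /= uphalf_half ec (negbTE ec) /=; lra.
Qed.

Lemma potential_ge0 {R : realType} (a b : R) (c : nat) (v : R) :
  0 <= a -> a < b -> 0 <= v -> 0 <= potential a b c v.
Proof.
move=> a0 ab v0; apply: addr_ge0; last by case: ifP.
by rewrite mulr_ge0// subr_ge0 ltW.
Qed.

Lemma measurable_potential {d} {T : measurableType d} {R : realType}
    (a b : R) (c : T -> nat) (v : T -> R) :
  measurable_fun setT c -> measurable_fun setT v ->
  measurable_fun setT (fun w => potential a b (c w) (v w)).
Proof.
move=> mc mv; apply: measurable_funD.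
  exact: (@measurableT_comp _ _ _ _ _ _
    (fun n : nat => (b - a) * (n./2)%:R)).
by apply: measurable_fun_ifT => //; exact: (@measurableT_comp _ _ _ _ _ _ odd).
Qed.

(** * Nonnegative supermartingales *)

(** The conditional expectation is avoided: the inequality between [V t] and
    the conditional mean of [V t.+1] is integrated over the events of [F t]. *)
Definition supermartingale {d} {T : measurableType d} {R : realType}
    (P : probability T R) (F : nat -> set (set T)) (V : nat -> T -> R) : Prop :=
  adapted F V /\
  forall t A, F t A ->
    (\int[P]_(w in A) (V t.+1 w)%:E <= \int[P]_(w in A) (V t w)%:E)%E.

Lemma switches_adapted {d} {T : measurableType d} {R : realType}
    (F : nat -> set (set T)) (V : nat -> T -> R) (a b : R) :
  filtration F -> adapted F V ->
  adapted F (fun t w => switches a b (V ^~ w) t).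
Proof.
move=> [sF homoF] mV.
have step t (c : T -> nat) : measurable_wrt (F t) c ->
    measurable_wrt (F t) (fun w => switch a b (c w) (V t w)).
  move=> mc; rewrite /measurable_wrt /switch.
  have -> : (fun w => c w +
      (if odd (c w) then (b <= V t w)%R else (V t w <= a)%R))%N =
    (fun w => if (if odd (c w) then b <= V t w else V t w <= a)
              then (c w).+1 else c w).
    by apply/funext => w; case: ifP => _; case: ifP => _ /=;
      rewrite ?addn0 ?addn1.
  have mnat d' (U : measurableType d') (f : nat -> U) :
    measurable_wrt (F t) (f \o c) by exact: measurableT_comp.
  apply: measurable_fun_ifT => //; last exact: mnat.
  apply: measurable_fun_ifT => //; first exact: mnat.
  - by apply: measurable_fun_ler => //; exact: mV.
  - by apply: measurable_fun_ler => //; exact: mV.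
elim=> [|t IH] /=; first by apply: step; exact: measurable_cst.
apply: step; apply: measurable_wrtW IH; [exact: (sF _).1|exact: (sF _).1|].
exact: homoF.
Qed.

(** By [potential_switch] one may freeze the counter while the process moves.
    The frozen potential depends on the process only on the event [B] that the
    phase is odd, and [B] belongs to [F t]: the supermartingale inequality on
    [B] gives the result. *)
Lemma potential_nonincreasing {d} {T : measurableType d} {R : realType}
    (P : probability T R) (F : nat -> set (set T)) (V : nat -> T -> R)
    (a b : R) (t : nat) :
  filtration F -> supermartingale P F V -> (forall s w, 0 <= V s w) ->
  0 <= a -> a < b ->
  (\int[P]_w (potential a b (switches a b (V ^~ w) t.+1) (V t.+1 w))%:E <=
   \int[P]_w (potential a b (switches a b (V ^~ w) t) (V t w))%:E)%E.
Proof.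
move=> fF [adV superV] V0 a0 ab.
have [sF homoF] := fF.
pose c s w := switches a b (V ^~ w) s.
have mc s : measurable_fun setT (c s).
  exact: (measurable_wrt_ambient _ _ (sF s)
    (switches_adapted _ _ a b fF adV s)).
have mV s : measurable_fun setT (V s)
    by exact: (measurable_wrt_ambient _ _ (sF s) (adV s)).
pose B := [set w | odd (c t w)].
have FB : F t B.
  apply: measurable_wrt_bool; first exact: (sF t).1.
  by apply: (@measurableT_comp _ _ _ _ _ _ odd) => //; exact: switches_adapted.
have mB : measurable B by exact: (sF t).2.
(* the part of the potential that the process does not influence *)
pose K w := (b - a) * ((c t w)./2)%:R + (if odd (c t w) then 0 else a).
have K0 w : 0 <= K w.
  apply: addr_ge0; last by case: ifP.
  by rewrite mulr_ge0// subr_ge0 ltW.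
have mK : measurable_fun setT K.
  exact: (@measurableT_comp _ _ _ _ _ _
    (fun n : nat => (b - a) * (n./2)%:R + (if odd n then 0 else a))).
have split_potential s : (\int[P]_w (potential a b (c t w) (V s w))%:E =
    \int[P]_w (K w)%:E + \int[P]_(w in B) (V s w)%:E)%E.
  rewrite [X in (_ + X)%E]integral_mkcond -ge0_integralD//; last 4 first.
  - by move=> w _; rewrite lee_fin.
  - exact/measurable_EFinP.
  - by move=> w _; apply: erestrict_ge0 => x _; rewrite lee_fin.
  - apply/(measurable_restrictT _ mB)/measurable_EFinP.
    exact: measurable_funTS.
  apply: eq_integral => w _; rewrite /potential /K /patch.
  have -> : (w \in B) = odd (c t w) by apply/idP/idP; rewrite inE.
  by case: ifP => _; rewrite ?addr0 ?adde0.
apply: (@le_trans _ _ (\int[P]_w (potential a b (c t w) (V t.+1 w))%:E)%E).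
  apply: ge0_le_integral => //.
  - by move=> w _; rewrite lee_fin; exact: potential_ge0.
  - apply/measurable_EFinP.
    exact: measurable_potential (mc t.+1) (mV t.+1).
  - apply/measurable_EFinP.
    exact: measurable_potential (mc t) (mV t.+1).
  - by move=> w _; rewrite lee_fin; exact: potential_switch.
by rewrite !split_potential leeD2l// superV.
Qed.

(** The mean potential stays below its initial bound [a], so that by Fatou's
    lemma the potential does not tend to infinity.  As it dominates [b - a]
    times the number of upcrossings, the latter stays bounded along almost
    every path. *)
Lemma supermartingale_no_oscillation {d} {T : measurableType d}
    {R : realType} (P : probability T R) (F : nat -> set (set T))
    (V : nat -> T -> R) (a b : R) :
  filtration F -> supermartingale P F V -> (forall s w, 0 <= V s w) ->
  0 <= a -> a < b ->
  {ae P, forall w, ~ oscillates (V ^~ w) a b}.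
Proof.
move=> fF superV V0 a0 ab.
have [sF homoF] := fF.
pose pot t w := potential a b (switches a b (V ^~ w) t) (V t w).
have pot_ge t w : (b - a) * ((switches a b (V ^~ w) t)./2)%:R <= pot t w.
  by rewrite lerDl; case: ifP.
have pot_ge0 t w : 0 <= pot t w by exact: potential_ge0.
have mpot t : measurable_fun setT (pot t).
  apply: measurable_potential; last first.
    exact: (measurable_wrt_ambient _ _ (sF t) (superV.1 t)).
  exact: (measurable_wrt_ambient _ _ (sF t)
    (switches_adapted _ _ a b fF superV.1 t)).
have int_pot t : (\int[P]_w (pot t w)%:E <= a%:E)%E.
  elim: t => [|t]; last first.
    by apply: le_trans; exact: potential_nonincreasing.
  apply: (@le_trans _ _ (\int[P]_w a%:E)%E).
    apply: ge0_le_integral => //.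
    - by move=> w _; rewrite lee_fin.
    - exact/measurable_EFinP.
    - move=> w _; rewrite lee_fin; apply: le_trans (potential_switch _ _ _ _) _.
      by rewrite /potential mulr0 add0r.
  by rewrite integral_cst//= [X in (_ * X)%E]probability_setT mule1.
apply: filterS (fatou_frequently_below P pot a mpot pot_ge0 int_pot).
move=> w [K below] osc.
have ba : 0 < b - a by rewrite subr_gt0.
have [t _ kt] := switches_unbounded a b _ ab osc
  (Num.bound (K / (b - a))).*2 0%N.
have ct s : (t <= s)%N -> K <= pot s w.
  move=> ts; apply: le_trans (pot_ge s w).
  rewrite mulrC -ler_pdivrMr//; apply: (le_trans (ltW (unstable.ltr_bound _))).
  rewrite ler_nat geq_half_double.
  exact: leq_trans kt (switches_homo _ _ _ _ _ ts).
have [s ts] := below t; apply/negP; rewrite -leNgt; exact: ct.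
Qed.

(** A rational gap is used for each possible oscillation, so that countably many
    null sets suffice; the bound on the mean of [V] excludes a limit equal to
    [+oo]. *)
Lemma supermartingale_cvgn {d} {T : measurableType d}
    {R : realType} (P : probability T R) (F : nat -> set (set T))
    (V : nat -> T -> R) (M : R) :
  filtration F -> supermartingale P F V -> (forall s w, 0 <= V s w) ->
  (\int[P]_w (V 0%N w)%:E <= M%:E)%E ->
  {ae P, forall w, cvgn (V ^~ w)}.
Proof.
move=> fF superV V0 VM.
have [sF homoF] := fF.
have int_V t : (\int[P]_w (V t w)%:E <= M%:E)%E.
  elim: t => // t; apply: le_trans; apply: superV.2.
  by have [] := (sF t).1 => H1 H2 _; have := H2 _ H1; rewrite setD0.
have mV t := measurable_wrt_ambient _ _ (sF t) (superV.1 t).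
have no_osc : {ae P, forall w, forall pq : rat * rat,
    0 <= ratr pq.1 :> R -> ratr pq.1 < ratr pq.2 :> R ->
    ~ oscillates (V ^~ w) (ratr pq.1) (ratr pq.2)}.
  apply: ae_forall_countable => -[p q] /=.
  have [p0|] := boolP (0 <= ratr p :> R); last by move=> _; exact: nearW.
  have [pq|] := boolP (ratr p < ratr q :> R); last by move=> _; exact: nearW.
  have := supermartingale_no_oscillation _ _ _ _ _ fF superV V0 p0 pq.
  exact: filterS.
have below := fatou_frequently_below P V M mV V0 int_V.
apply: filterS2 no_osc below => w no_osc [K below].
apply: (@cvgn_no_oscillation R (V ^~ w) K) => // p q p0 pq.
exact: (no_osc (p, q)).
Qed.

(** * The killed compensated process *)

Lemma nneseries_ltyP {R : realType} (x : nat -> R) :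
  (forall t, 0 <= x t) ->
  (\sum_(0 <= t <oo) (x t)%:E < +oo)%E <->
  exists M, forall t, \sum_(i < t) x i <= M.
Proof.
move=> x0.
have x0E t : (0 <= t)%N -> true -> (0 <= (x t)%:E)%E by rewrite lee_fin.
split=> [xoo|[M xM]].
  exists (fine (\sum_(0 <= t <oo) (x t)%:E)%E) => t.
  rewrite -lee_fin fineK; last first.
    by rewrite ge0_fin_numE//; exact: nneseries_ge0.
  rewrite -sumEFin -(big_mkord predT (fun i => (x i)%:E)).
  exact: nneseries_lim_ge.
apply: (@le_lt_trans _ _ M%:E); last exact: ltry.
apply: lime_le; first exact: is_cvg_nneseries.
by apply: nearW => t; rewrite sumEFin lee_fin big_mkord.
Qed.

Lemma partial_sum_homo {R : realType} (x : nat -> R) :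
  (forall t, 0 <= x t) ->
  {homo (fun t => \sum_(i < t) x i) : s t / (s <= t)%N >-> s <= t}.
Proof.
move=> x0; apply/nondecreasing_seqP => t.
by rewrite big_ord_recr lerDl.
Qed.

(** The bound [n <= t.+1] rather than [n <= t] expresses that the partial sums
    of an adapted process are predictable. *)
Lemma measurable_wrt_sum {d} {T : measurableType d} {R : realType}
    (F : nat -> set (set T)) (X : nat -> T -> R) (n t : nat) :
  filtration F -> adapted F X -> (n <= t.+1)%N ->
  measurable_wrt (F t) (fun w => \sum_(i < n) X i w).
Proof.
move=> [sF homoF] adX nt; rewrite /measurable_wrt.
elim: n nt => [|n IH] nt.
  by under eq_fun do rewrite big_ord0; exact: measurable_cst.
under eq_fun do rewrite big_ord_recr/=.
apply: measurable_funD; first exact: IH (ltnW nt).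
apply: measurable_wrtW (adX n); [exact: (sF _).1|exact: (sF _).1|].
exact: homoF.
Qed.

Definition compensated {T : Type} {R : realType} (X Y Z : nat -> T -> R)
    (t : nat) (w : T) : R :=
  Y t w + \sum_(i < t) X i w - \sum_(i < t) Z i w.

(** The compensated process, raised by [a] and sent to [0] when the partial sums
    of [Z] exceed [a], or from the start if [Y 0] does. *)
Definition killed {T : Type} {R : realType} (X Y Z : nat -> T -> R) (a : R)
    (t : nat) (w : T) : R :=
  if (Y 0%N w <= a) && (\sum_(i < t) Z i w <= a)
  then compensated X Y Z t w + a else 0.

Lemma killed_ge0 {T : Type} {R : realType} (X Y Z : nat -> T -> R) (a : R)
    (t : nat) (w : T) :
  (forall s w, [/\ 0 <= X s w, 0 <= Y s w & 0 <= Z s w]) ->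
  0 <= killed X Y Z a t w.
Proof.
move=> ge0; rewrite /killed /compensated.
case: ifP => // /andP[_ Za]; have [_ Y0 _] := ge0 t w.
have : 0 <= \sum_(i < t) X i w.
  by apply: sumr_ge0 => i _; have [] := ge0 i w.
by move: Za Y0; lra.
Qed.

(** On the event [D] of survival until [t.+1], which belongs to [F t], the
    killed process at [t.+1] is [Y t.+1 + L] for some nonnegative
    [F t]-measurable [L].  Integrating over a part of [D] in [F t] replaces [Y t.+1] by its
    conditional expectation, and the hypothesis bounds the result by the killed
    process at [t].  The paths killed between [t] and [t.+1] contribute [0] on
    the left and a nonnegative amount on the right. *)
Lemma killed_supermartingale {d} {T : measurableType d} {R : realType}
    (P : probability T R) (F : nat -> set (set T)) (X Y Z : nat -> T -> R)
    (a : R) :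
  filtration F -> adapted F X -> adapted F Y -> adapted F Z ->
  (forall t w, [/\ 0 <= X t w, 0 <= Y t w & 0 <= Z t w]) ->
  (forall t, exists2 g : T -> \bar R,
     is_condexp P (F t) (Y t.+1) g &
     {ae P, forall w, (g w <= (Y t w - X t w + Z t w)%:E)%E}) ->
  supermartingale P F (killed X Y Z a).
Proof.
move=> fF adX adY adZ ge0 condexp_le.
have [sF homoF] := fF.
have Y0t t : measurable_wrt (F t) (Y 0%N).
  apply: measurable_wrtW (adY 0%N); [exact: (sF _).1|exact: (sF _).1|].
  exact: homoF.
have malive n t : (n <= t.+1)%N -> measurable_wrt (F t)
    (fun w => (Y 0%N w <= a) && (\sum_(i < n) Z i w <= a)).
  move=> nt; apply: measurable_and; apply: measurable_fun_ler => //.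
  - exact: Y0t.
  - exact: measurable_wrt_sum.
have mcomp t : measurable_wrt (F t) (compensated X Y Z t).
  apply: measurable_funB; last exact: measurable_wrt_sum.
  by apply: measurable_funD; [exact: adY|exact: measurable_wrt_sum].
have adK : adapted F (killed X Y Z a).
  move=> t; apply: measurable_fun_ifT => //; first exact: malive.
  by apply: measurable_funD => //; exact: mcomp.
split=> // t A FA.
have mA : measurable A by exact: (sF t).2.
pose D := [set w | (Y 0%N w <= a) && (\sum_(i < t.+1) Z i w <= a)].
have FD : F t D by apply: measurable_wrt_bool; [exact: (sF t).1|exact: malive].
have FAD : F t (A `&` D).
  have := @measurableI _ (g_sigma_algebraType (F t)) A D.
  rewrite /measurable/= sigma_algebra_id; last exact: (sF t).1.
  exact.
have mAD : measurable (A `&` D) by exact: (sF t).2.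
pose L w := \sum_(i < t.+1) X i w - \sum_(i < t.+1) Z i w + a.
have mL : measurable_fun setT L.
  apply: (measurable_wrt_ambient _ _ (sF t)).
  apply: measurable_funD => //; apply: measurable_funB;
    exact: measurable_wrt_sum.
have L0 w : D w -> 0 <= L w.
  move=> /andP[_ Za]; rewrite /L.
  have : 0 <= \sum_(i < t.+1) X i w.
    by apply: sumr_ge0 => i _; have [] := ge0 i w.
  by move: Za; lra.
have mY s : measurable_fun setT (Y s).
  exact: (measurable_wrt_ambient _ _ (sF s) (adY s)).
have mK s : measurable_fun setT (killed X Y Z a s).
  exact: (measurable_wrt_ambient _ _ (sF s) (adK s)).
have [g [mg g0 gY] g_le] := condexp_le t.
have {}mg : measurable_fun setT g by exact: (measurable_wrt_ambient _ _ (sF t)).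
have mTAD d' (U : measurableType d') (f : T -> U) :
  measurable_fun setT f -> measurable_fun (A `&` D) f.
  exact: measurable_funTS.
apply: (@le_trans _ _ (\int[P]_(w in A `&` D) (killed X Y Z a t w)%:E)%E);
  last first.
  apply: ge0_subset_integral => //.
  - by apply/measurable_EFinP; exact: measurable_funTS.
  - by move=> w _; rewrite lee_fin; exact: killed_ge0.
have -> : (\int[P]_(w in A) (killed X Y Z a t.+1 w)%:E =
    \int[P]_(w in A `&` D) ((Y t.+1 w)%:E + (L w)%:E))%E.
  rewrite integral_mkcondr; apply: eq_integral => w _; rewrite /patch.
  have -> : (w \in D) =
      (Y 0%N w <= a) && (\sum_(i < t.+1) Z i w <= a).
    by apply/idP/idP; rewrite inE.
  rewrite /killed /compensated /L; case: ifP => // _.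
  by rewrite -EFinD !addrA.
rewrite ge0_integralD//; last 4 first.
- by move=> w _; rewrite lee_fin; have [] := ge0 t.+1 w.
- exact/measurable_EFinP/mTAD.
- by move=> w [_ Dw]; rewrite lee_fin; exact: L0.
- exact/measurable_EFinP/mTAD.
rewrite -gY// -ge0_integralD//; last 3 first.
- exact: mTAD.
- by move=> w [_ Dw]; rewrite lee_fin; exact: L0.
- exact/measurable_EFinP/mTAD.
apply: ae_ge0_le_integral => //.
- by move=> w [_ Dw]; rewrite adde_ge0// lee_fin; exact: L0.
- apply: emeasurable_funD; first exact: mTAD.
  exact/measurable_EFinP/mTAD.
- by move=> w _; rewrite lee_fin; exact: killed_ge0.
- exact/measurable_EFinP/mTAD.
apply: filterS g_le => w g_le [_ Dw].
have -> : killed X Y Z a t w = Y t w - X t w + Z t w + L w.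
  have /andP[Ya Za] := Dw; have [_ _ Z0] := ge0 t w.
  rewrite /killed Ya ifT; last first.
    by apply: le_trans Za; rewrite big_ord_recr lerDl.
  by rewrite /compensated /L !big_ord_recr/=; lra.
by rewrite [leRHS]EFinD leeD2r.
Qed.

Lemma killed_cvgn {d} {T : measurableType d} {R : realType}
    (P : probability T R) (F : nat -> set (set T)) (X Y Z : nat -> T -> R)
    (a : R) :
  0 <= a ->
  filtration F -> adapted F X -> adapted F Y -> adapted F Z ->
  (forall t w, [/\ 0 <= X t w, 0 <= Y t w & 0 <= Z t w]) ->
  (forall t, exists2 g : T -> \bar R,
     is_condexp P (F t) (Y t.+1) g &
     {ae P, forall w, (g w <= (Y t w - X t w + Z t w)%:E)%E}) ->
  {ae P, forall w, cvgn (killed X Y Z a ^~ w)}.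
Proof.
move=> a0 fF adX adY adZ ge0 condexp_le.
have superK := killed_supermartingale _ _ _ _ _ a fF adX adY adZ ge0 condexp_le.
apply: (supermartingale_cvgn _ _ _ (a + a) fF superK) => [s w|].
  exact: killed_ge0.
apply: (@le_trans _ _ (\int[P]_w (a + a)%:E)%E); last first.
  by rewrite integral_cst//= [X in (_ * X)%E]probability_setT mule1.
apply: ge0_le_integral => //.
- by move=> w _; rewrite lee_fin; exact: killed_ge0.
- apply/measurable_EFinP.
  exact: (measurable_wrt_ambient _ _ (fF.1 0%N) (superK.1 0%N)).
- move=> w _; rewrite lee_fin /killed /compensated !big_ord0.
  by case: ifP => [/andP[Ya _]|_]; [lra|rewrite addr_ge0].
Qed.

(** For an integer level [n] above [Y 0 w] and the sum of the [Z t w], the path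
    [w] is never killed, so the killed process is [Y_t + S_t - C_t + n] along
    it.  Adding back the convergent [C_t] shows that [Y_t + S_t] converges, and
    [Y_t >= 0] bounds the nondecreasing [S_t]. *)
Lemma cvgn_of_killed {T : Type} {R : realType} (X Y Z : nat -> T -> R) (w : T) :
  (forall t w, [/\ 0 <= X t w, 0 <= Y t w & 0 <= Z t w]) ->
  (forall n : nat, cvgn (killed X Y Z n%:R ^~ w)) ->
  (\sum_(0 <= t <oo) (Z t w)%:E < +oo)%E ->
  (\sum_(0 <= t <oo) (X t w)%:E < +oo)%E /\ cvgn (Y ^~ w).
Proof.
move=> ge0 cvgK sumZ.
have X0 t : 0 <= X t w by have [] := ge0 t w.
have Y0 t : 0 <= Y t w by have [] := ge0 t w.
have Z0 t : 0 <= Z t w by have [] := ge0 t w.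
have [M ZM] := (nneseries_ltyP _ Z0).1 sumZ.
have cvg_sum (x : nat -> R) (B : R) : (forall t, 0 <= x t) ->
    (forall t, \sum_(i < t) x i <= B) -> cvgn (fun t => \sum_(i < t) x i).
  move=> x0 xB; apply: nondecreasing_is_cvgn; first exact: partial_sum_homo.
  by exists B => _ [t _ <-].
have cvgZ := cvg_sum _ _ Z0 ZM.
pose n := maxn (Num.bound (Y 0%N w)) (Num.bound M).
have nP (x : R) : x < (Num.bound x)%:R by exact: unstable.ltr_bound.
have Yn : Y 0%N w <= n%:R.
  by apply: le_trans (ltW (nP _)) _; rewrite ler_nat leq_maxl.
have Mn : M <= n%:R.
  by apply: le_trans (ltW (nP _)) _; rewrite ler_nat leq_maxr.
have cvgYX : cvgn (fun t => Y t w + \sum_(i < t) X i w).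
  rewrite (_ : (fun t => _) = ((killed X Y Z n%:R ^~ w) +
      (fun t => \sum_(i < t) Z i w)) - cst n%:R).
    by apply: is_cvgB; [exact: is_cvgD|exact: is_cvg_cst].
  apply/funext => t; rewrite !fctE /killed Yn (le_trans (ZM t) Mn)/=.
  by rewrite /compensated; lra.
have [B [_ /(_ (B + 1))]] := cvg_seq_bounded cvgYX.
rewrite ltrDl => /(_ ltr01) YXB.
have XB t : \sum_(i < t) X i w <= B + 1.
  have /= := YXB t I; rewrite ger0_norm; last first.
    by rewrite addr_ge0// sumr_ge0.
  by apply: le_trans; rewrite lerDr.
split; first by apply/nneseries_ltyP => //; exists (B + 1).
rewrite (_ : Y ^~ w =
  (fun t => Y t w + \sum_(i < t) X i w) - (fun t => \sum_(i < t) X i w)).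
  by apply: is_cvgB => //; exact: cvg_sum X0 XB.
by apply/funext => t; rewrite !fctE addrK.
Qed.

Theorem theorem18 (d : measure_display) (T : measurableType d) (R : realType)
    (P : probability T R) (F : nat -> set (set T))
    (X Y Z : nat -> {RV P >-> R})
    (F_filtration : filtration F)
    (X_adapted : adapted F (fun t => X t : T -> R))
    (Y_adapted : adapted F (fun t => Y t : T -> R))
    (Z_adapted : adapted F (fun t => Z t : T -> R))
    (XYZ_ge0 : forall t w, [/\ 0 <= X t w, 0 <= Y t w & 0 <= Z t w])
    (condexp_le : forall t, exists2 g : T -> \bar R,
       is_condexp P (F t) (Y t.+1) g &
       {ae P, forall w, (g w <= (Y t w - X t w + Z t w)%:E)%E})
    (sum_Z : {ae P, forall w, (\sum_(0 <= t <oo) (Z t w)%:E < +oo)%E}) :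
  {ae P, forall w, (\sum_(0 <= t <oo) (X t w)%:E < +oo)%E} /\
  exists Yinf : {RV P >-> R},
    (forall w, 0 <= Yinf w) /\
    {ae P, forall w, (fun t => Y t w) @ \oo --> Yinf w}.
Proof.
have cvgK : {ae P, forall w, forall n : nat,
    cvgn ((killed (fun t => X t) (fun t => Y t) (fun t => Z t) n%:R) ^~ w)}.
  by apply: ae_foralln => n; exact: killed_cvgn condexp_le.
have XY : {ae P, forall w,
    (\sum_(0 <= t <oo) (X t w)%:E < +oo)%E /\ cvgn (fun t => Y t w)}.
  by apply: filterS2 cvgK sum_Z => w; exact: cvgn_of_killed.
split; first by apply: filterS XY => w [].
(* The upper limit is measurable whether or not the path converges, and [fine]
   makes it a nonnegative real number where it is [+oo]. *)
pose f w := fine (limn_esup (fun t => (Y t w)%:E)).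
have mf : measurable_fun setT f.
  apply: measurableT_comp; first exact: fine_measurable.
  apply: measurable_fun_limn_esup => t; apply/measurable_EFinP.
  exact: measurable_funP.
exists (mfun_Sub (mem_set mf : f \in mfun)); split=> [w|].
  rewrite /= /f fine_ge0// limn_esup_lim.
  apply: lime_ge; first exact: is_cvg_esups.
  apply: nearW => n; apply: (@le_trans _ _ (Y n w)%:E).
    by rewrite lee_fin; have [_ ? _] := XYZ_ge0 n w.
  by apply: ereal_sup_ubound; exists n => /=.
apply: filterS XY => w [_ /cvg_ex[l Yl]] /=.
have : (fun t => (Y t w)%:E) @ \oo --> l%:E.
  by apply/fine_cvgP; split; [exact: nearW|exact: Yl].
by rewrite /f => /cvg_limn_einf_sup[_ ->].
Qed.
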